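(* Suppose every activation function is ReLU, i.e. $\sigma_i(z)=\max\{0,z\}$ for $i=1,\dots,d-1$, and let $\mathcal{F}_{nn}$ be the class of depth-$d$ networks with parameter set $\mathcal{W}_F$. Then for all $m,n\ge1$, $$\inf_{\hat d(n,m)}\ \sup_{\mu,\nu\in\mathcal{P}_{uB}}\mathbb{P}\left\{\left|d_{\mathcal{F}_{nn}}(\mu,\nu)-\hat d(n,m)\right|\ge 0.08\,\Gamma_{uB}\prod_{i=1}^dM_F(i)\,\max\left(n^{-1/2},m^{-1/2}\right)\right\}\ge\frac14.$$ The same result holds when the parameter set is $\mathcal{W}_{1,\infty}$, with each $M_F(i)$ replaced by $M_{1,\infty}(i)$.
   Context: Fix integers $h\ge1$ (input dimension), $d\ge2$ (depth), and layer widths $k_1=h,k_2,\dots,k_d\ge1$. For a matrix $\mathbf{W}$, $\|\mathbf{W}\|_F$ is the Frobenius norm and $\|\mathbf{W}\|_{1,\infty}$ is the maximal $\ell_1$ norm of its rows; $\|\cdot\|$ on vectors is the $\ell_2$ norm and $\|\cdot\|_1$ the $\ell_1$ norm. Networks: a depth-$d$ neural network is a function $f:\mathbb{R}^h\to\mathbb{R}$, $f(\mathbf{x})=\mathbf{w}_d^T\sigma_{d-1}(\mathbf{W}_{d-1}\sigma_{d-2}(\cdots\sigma_1(\mathbf{W}_1\mathbf{x})))$, where $\mathbf{W}_i\in\mathbb{R}^{k_{i+1}\times k_i}$ for $i=1,\dots,d-1$, $\mathbf{w}_d\in\mathbb{R}^{k_d}$, and the $\sigma_i$ are applied entrywise.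 Given positive constants $M_F(i)$, $M_{1,\infty}(i)$, $i=1,\dots,d$, the parameter sets are: $\mathcal{W}_F$, all $(\mathbf{W}_1,\dots,\mathbf{W}_{d-1},\mathbf{w}_d)$ with $\|\mathbf{W}_i\|_F\le M_F(i)$ for $i\le d-1$ and $\|\mathbf{w}_d\|\le M_F(d)$; and $\mathcal{W}_{1,\infty}$, all such tuples with $\|\mathbf{W}_i\|_{1,\infty}\le M_{1,\infty}(i)$ for $i\le d-1$ and $\|\mathbf{w}_d\|_1\le M_{1,\infty}(d)$. $\mathcal{F}_{nn}$ is the set of all such networks with parameters in the given parameter set. Neural net distance: $d_{\mathcal{F}_{nn}}(\mu,\nu)=\sup_{f\in\mathcal{F}_{nn}}|\mathbb{E}_{\mathbf{x}\sim\mu}f(\mathbf{x})-\mathbb{E}_{\mathbf{x}\sim\nu}f(\mathbf{x})|$. Class $\mathcal{P}_{uB}$: given $\Gamma_{uB}>0$, $\mathcal{P}_{uB}$ is the set of all Borel probability measures $\mu$ on $\mathbb{R}^h$ with unbounded support such that $\|\mathbb{E}_{\mathbf{x}\sim\mu}\mathbf{x}\|\le\Gamma_{uB}$ and, for some $\tau$ with $0<\tau\le\Gamma_{uB}$, $\mathbb{E}_{\mathbf{x}\sim\mu}e^{\mathbf{a}^T(\mathbf{x}-\mathbb{E}\mathbf{x})}\le e^{\|\mathbf{a}\|^2\tau^2/2}$ for all $\mathbf{a}\in\mathbb{R}^h$. Minimax setting: $\mathbf{x}_1,\dots,\mathbf{x}_n$ are i.i.d. from $\mu$ and, independently, $\mathbf{y}_1,\dots,\mathbf{y}_m$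 are i.i.d. from $\nu$; $\mathbb{P}=\mu^n\times\nu^m$ is the law of the samples. The infimum is over all estimators $\hat d(n,m)$, i.e. all real-valued measurable functions of the $n+m$ samples. *)

(* Defs.v *)
From HB Require Import structures.
From mathcomp Require Import all_boot all_order all_algebra.
From mathcomp Require Import all_classical all_reals all_analysis.
Set Implicit Arguments.
Unset Strict Implicit.
Unset Printing Implicit Defensive.
Import Order.TTheory GRing.Theory Num.Theory.
Import numFieldNormedType.Exports.
Local Open Scope classical_set_scope.
Local Open Scope ring_scope.

(** The library norm [`|_|] on matrices is the max norm, so the norms below are
    defined by hand. *)
Definition frobenius_norm (R : realType) (m n : nat) (A : 'M[R]_(m, n)) : R :=
  Num.sqrt (\sum_(i < m) \sum_(j < n) A i j ^+ 2).

Definition max_row_l1_norm (R : realType) (m n : nat) (A : 'M[R]_(m, n)) : R :=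
  \big[Num.max/0]_(i < m) \sum_(j < n) `|A i j|.

Definition l2_norm (R : realType) (n : nat) (v : 'cV[R]_n) : R :=
  Num.sqrt (\sum_(i < n) v i 0 ^+ 2).

Definition l1_norm (R : realType) (n : nat) (v : 'cV[R]_n) : R :=
  \sum_(i < n) `|v i 0|.

Definition dot (R : realType) (n : nat) (u v : 'cV[R]_n) : R := (u^T *m v) 0 0.

(** [R^h] with its Borel sigma-algebra; the topology induced by the max norm is
    the usual one.  The carrier is ['cV[R]_h] itself. *)
Definition borel_vec (R : realType) (h : nat) :=
  g_sigma_algebraType (@open 'cV[R]_h).

(** Networks.  Layers are numbered from 1: layer [i] has width [k i], the input
    dimension is [k 1], and [W i] maps layer [i] to layer [i.+1].  [L] is the
    number of hidden layers, so the depth is [L.+1] and the output vector lives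
    in [R^(k L.+1)].  Only [W 1, ..., W L] and [sigma 1, ..., sigma L] are
    used. *)
Definition weights (R : realType) (k : nat -> nat) :=
  forall i : nat, 'M[R]_(k i.+1, k i).

Fixpoint hidden (R : realType) (k : nat -> nat) (sigma : nat -> R -> R)
    (W : weights R k) (x : 'cV[R]_(k 1%N)) (L : nat) : 'cV[R]_(k L.+1) :=
  match L with
  | 0 => x
  | l.+1 => map_mx (sigma l.+1) (W l.+1 *m hidden sigma W x l)
  end.

Definition network (R : realType) (k : nat -> nat) (L : nat)
    (sigma : nat -> R -> R) (W : weights R k) (w : 'cV[R]_(k L.+1))
    (x : 'cV[R]_(k 1%N)) : R :=
  dot w (hidden sigma W x L).

Definition relu (R : realType) (z : R) : R := Num.max 0 z.

Definition params_frobenius (R : realType) (k : nat -> nat) (L : nat)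
    (M : nat -> R) : set (weights R k * 'cV[R]_(k L.+1)) :=
  [set p | (forall i, (1 <= i <= L)%N -> frobenius_norm (p.1 i) <= M i)
           /\ l2_norm p.2 <= M L.+1].

Definition params_max_row_l1 (R : realType) (k : nat -> nat) (L : nat)
    (M : nat -> R) : set (weights R k * 'cV[R]_(k L.+1)) :=
  [set p | (forall i, (1 <= i <= L)%N -> max_row_l1_norm (p.1 i) <= M i)
           /\ l1_norm p.2 <= M L.+1].

Definition network_class (R : realType) (k : nat -> nat) (L : nat)
    (sigma : nat -> R -> R) (Theta : set (weights R k * 'cV[R]_(k L.+1))) :
    set (borel_vec R (k 1%N) -> R) :=
  [set network sigma p.1 p.2 | p in Theta].

(** Extended-real valued: no boundedness of the supremum is presupposed.  Both
    expectations are finite for the continuous networks and the measures of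
    [P_uB] below. *)
Definition net_distance (R : realType) (h : nat) (F : set (borel_vec R h -> R))
    (mu nu : probability (borel_vec R h) R) : \bar R :=
  ereal_sup [set (`| 'E_mu[f] - 'E_nu[f] |)%E | f in F].

Definition msupport (R : realType) (h : nat)
    (mu : probability (borel_vec R h) R) : set 'cV[R]_h :=
  [set x | forall U : set 'cV[R]_h, open U -> U x -> (0 < mu U)%E].

Definition mean_vec (R : realType) (h : nat)
    (mu : probability (borel_vec R h) R) : 'cV[R]_h :=
  \col_(i < h) fine 'E_mu[fun x : borel_vec R h => (x : 'cV[R]_h) i 0].

Definition sub_gaussian (R : realType) (h : nat)
    (mu : probability (borel_vec R h) R) (tau : R) : Prop :=
  forall a : 'cV[R]_h,
    let Z (x : borel_vec R h) : R := expR (dot a ((x : 'cV[R]_h) - mean_vec mu)) in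
    let b : R := expR (l2_norm a ^+ 2 * tau ^+ 2 / 2) in
    ('E_mu[Z] <= b%:E)%E.

(** [bounded_set] refers to the max norm, which has the same bounded sets as the
    [l2] norm.  The integrability clause makes [mean_vec] the genuine mean (it also
    follows from the sub-Gaussian clause). *)
Definition P_uB (R : realType) (h : nat) (Gamma : R) :
    set (probability (borel_vec R h) R) :=
  [set mu |
    [/\ ~ bounded_set (msupport mu),
        forall i : 'I_h, mu.-integrable [set: borel_vec R h]
          (fun x : borel_vec R h => ((x : 'cV[R]_h) i 0)%:E),
        l2_norm (mean_vec mu) <= Gamma
      & exists2 tau : R, 0 < tau <= Gamma & sub_gaussian mu tau]].

Section iid.
Context d (T : measurableType d) (R : realType).

Definition tuple_cons (n : nat) (p : T * n.-tuple T) : n.+1.-tuple T :=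
  [tuple of p.1 :: p.2].

Lemma measurable_tuple_cons n : measurable_fun setT (@tuple_cons n).
Proof. exact: measurable_cons. Qed.

HB.instance Definition _ n :=
  isMeasurableFun.Build _ _ _ _ (@tuple_cons n) (@measurable_tuple_cons n).

(** The [n]-fold product [P^n], i.e. the law of [n] i.i.d. draws from [P]. *)
Fixpoint iid (P : probability T R) (n : nat) : probability (n.-tuple T) R :=
  match n with
  | 0 => dirac [tuple]
  | n'.+1 => distribution (P \x iid P n')%E (@tuple_cons n')
  end.

Lemma measurable_rectangle n (A : 'I_n -> set T) :
  (forall i, measurable (A i)) ->
  measurable [set t : n.-tuple T | forall i, A i (tnth t i)].
Proof.
move=> mA; rewrite (_ : [set t | _] =
    \bigcap_(i in [set: 'I_n]) ((fun t : n.-tuple T => tnth t i) @^-1` A i)).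
  apply: fin_bigcap_measurable => [|i _]; first exact: finite_finset.
  by rewrite -[X in measurable X]setTI; apply: measurable_tnth.
by apply/seteqP; split=> t /= h i; [move=> _|]; apply: h.
Qed.

Lemma iidE (P : probability T R) n (A : 'I_n -> set T) :
  (forall i, measurable (A i)) ->
  iid P n [set t | forall i, A i (tnth t i)] = (\prod_(i < n) P (A i))%E.
Proof.
elim: n A => [|n IH] A mA.
  by rewrite big_ord0 /= diracE mem_set// => -[].
rewrite big_ord_recl -IH => [|i]; last exact: mA.
rewrite -product_measure1E => [||].
- rewrite /= /distribution /pushforward; congr (product_measure1 _ _ _).
  apply/seteqP; split=> -[x t] /=.
    by move=> h; split=> [|i]; [exact: (h ord0)|have := h (lift ord0 i); rewrite tnthS].
  move=> [h0 h] i; case: (unliftP ord0 i) => [j|] ->; last exact: h0.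
  by rewrite tnthS.
- exact: mA.
- apply: (measurable_rectangle (A := fun i => A (lift ord0 i))) => i; exact: mA.
Qed.

End iid.

(** Infimum over the measurable real estimators [dhat], supremum over
    [mu, nu] in [Q], of the probability of an error at least [c]. *)
Definition minimax_prob (R : realType) (h : nat)
    (F : set (borel_vec R h -> R)) (Q : set (probability (borel_vec R h) R))
    (n m : nat) (c : R) : \bar R :=
  ereal_inf
    [set ereal_sup
        [set ((iid mu n \x iid nu m)
                [set s | c%:E <= `| net_distance F mu nu - (dhat s)%:E |])%E
        | mu in Q & nu in Q]
    | dhat in [set dhat : n.-tuple (borel_vec R h) * m.-tuple (borel_vec R h)
                          -> R | measurable_fun setT dhat]].

(* Main.v *)
Require Import Defs.
From mathcomp Require Import all_boot all_order all_algebra.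
From mathcomp Require Import all_classical all_reals all_analysis.
From mathcomp Require Import measurable_realfun ring lra.
Set Implicit Arguments.
Unset Strict Implicit.
Unset Printing Implicit Defensive.
Import Order.TTheory GRing.Theory Num.Theory.
Import numFieldNormedType.Exports.
Local Open Scope classical_set_scope.
Local Open Scope ring_scope.

(** Le Cam's two-point method with Gaussians carried by a coordinate axis.  Let
    [e] be the first basis vector.  The null pair is the law of [Z e],
    [Z ~ N(0, Gamma^2)], taken twice, at distance 0; in the alternative the
    measure with the smaller sample size [N] is replaced by the law of [Z e],
    [Z ~ N(delta, Gamma^2)], with [delta = Gamma N^(-1/2) / 2].

    Separation: [P relu(x_0)] and [P relu(- x_0)], with [P] the product of the
    norm bounds, both belong to the class and their difference is [P x_0], whose
    expectation moves by [P delta]; so one of the two expectations moves by at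
    least [P delta / 2], which exceeds twice the threshold.

    Indistinguishability: with [C] the second moment of the likelihood ratio,
    [(E_1 phi)^2 <= C E_0 (phi^2)] for all [phi >= 0].  This inequality tensorizes
    by Tonelli, and here it holds for the samples with [C^N = exp(1/4) <= 2].  For
    an indicator it gives [P_1(A)^2 <= 2 P_0(A)], hence
    [P_0(A) + P_1(~A) >= 1/2]. *)

(** * The normal distribution *)

(** Change of variables produces the Radon-Nikodym derivative, which equals [normal_pdf] almost
    everywhere because the two have the same integral over every measurable set. *)
Lemma ge0_integral_normal_prob (R : realType) (a s : R) (f : R -> \bar R) :
  measurable_fun setT f -> (forall x, 0 <= f x)%E ->
  (\int[normal_prob a s]_x f x =
   \int[lebesgue_measure]_x (f x * (normal_pdf a s x)%:E))%E.
Proof.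
move=> mf f0.
have dom : normal_prob a s `<< (@lebesgue_measure R).
  exact: normal_prob_dominates.
have RNi := Radon_Nikodym_SigmaFinite.f_integrable dom.
have mp : measurable_fun setT (fun x => (normal_pdf a s x)%:E).
  by apply/measurable_EFinP; exact: measurable_normal_pdf.
rewrite -(Radon_Nikodym_SigmaFinite.change_of_variables dom f0)//.
apply: ae_eq_integral => //.
- by apply: emeasurable_funM => //; exact: measurable_int RNi.
- exact: emeasurable_funM.
- apply: ae_eqe_mul2l; apply: integral_ae_eq => // E _ mE.
  by rewrite -Radon_Nikodym_SigmaFinite.f_integral.
Qed.

(** By completing the square in the exponent. The moment generating function follows, because the
    shifted density still integrates to 1. *)
Lemma normal_pdf_expR_shift (R : realType) (a b s x : R) : s != 0 ->
  expR (b * (x - a)) * normal_pdf a s x =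
  expR (b ^+ 2 * s ^+ 2 / 2) * normal_pdf (a + b * s ^+ 2) s x.
Proof.
move=> s0; rewrite !normal_pdfE// mulrCA [RHS]mulrCA; congr (_ * _).
rewrite /normal_fun -!expRD; congr expR; field.
by rewrite s0.
Qed.

Lemma normal_prob_mgf (R : realType) (a b s : R) : s != 0 ->
  (\int[normal_prob a s]_x (expR (b * (x - a)))%:E
   = (expR (b ^+ 2 * s ^+ 2 / 2))%:E)%E.
Proof.
move=> s0; rewrite ge0_integral_normal_prob; last 2 first.
- apply/measurable_EFinP; apply: measurableT_comp => //.
  by apply: measurable_funM => //; exact: measurable_funB.
- by move=> x; rewrite lee_fin expR_ge0.
under eq_integral do rewrite -EFinM normal_pdf_expR_shift// EFinM.
rewrite ge0_integralZl//.
- by rewrite integral_normal_pdf mule1.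
- by apply/measurable_EFinP; exact: measurable_normal_pdf.
- by move=> x _; rewrite lee_fin normal_pdf_ge0.
Qed.

(** The right side is [1 + O(b^2)], so a nonzero slope [t] is refuted by a small [b] of the same
    sign, here [b = e * t]. *)
Lemma eq0_of_expR_quadratic_bound (R : realType) (t v : R) : 0 <= v ->
  (forall b, 1 + b * t <= expR (b ^+ 2 * v)) -> t = 0.
Proof.
move=> v0 H; apply/eqP; apply: contraT => t0.
have tt : 0 < t ^+ 2 by rewrite exprn_even_gt0.
(* This choice makes [A = e * v] and [B = e * t ^+ 2] satisfy [A + B <= 1/2]. With [u = A * B],
   multiplying [1 + B <= exp u] by [1 - u <= exp (- u)] gives [B * (1 - A - A * B) <= 0], which is
   impossible. *)
pose e := (2 * (1 + v + t ^+ 2))^-1.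
have D0 : 0 < 2 * (1 + v + t ^+ 2) by lra.
have e0 : 0 < e by rewrite invr_gt0.
have eD : e * (2 * (1 + v + t ^+ 2)) = 1 by rewrite mulVf ?gt_eqF.
have := H (e * t); set u := (e * t) ^+ 2 * v.
have uE : u = (e * v) * (e * t ^+ 2) by rewrite /u; ring.
have Nu := expR_ge1Dx (- u).
have eu : expR u * expR (- u) = 1 by rewrite -expRD subrr expR0.
have u1 : 0 < expR u by exact: expR_gt0.
rewrite (_ : e * t * t = e * t ^+ 2); last by ring.
move: uE eD; set A := e * v; set B := e * t ^+ 2 => uE eD Hu.
have A0 : 0 <= A by rewrite mulr_ge0// ltW.
have B0 : 0 < B by rewrite mulr_gt0.
have AB : A + B <= 2^-1 by rewrite /A /B; nra.
have : (1 + B) * (1 - u) <= 1 by rewrite -eu; apply: ler_pM => //; nra.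
rewrite uE => H1.
have : B * (1 - A - A * B) <= 0 by lra.
by rewrite pmulr_rle0//; nra.
Qed.

Lemma integrable_normal_prob_expR (R : realType) (a b s : R) : s != 0 ->
  (normal_prob a s).-integrable [set: R] (fun x : R => (expR (b * (x - a)))%:E).
Proof.
move=> s0; apply/integrableP; split.
  apply/measurable_EFinP; apply: measurableT_comp => //.
  by apply: measurable_funM => //; exact: measurable_funB.
under eq_integral do rewrite gee0_abs ?lee_fin ?expR_ge0//.
by rewrite normal_prob_mgf// ltry.
Qed.

Lemma integrable_normal_prob_id (R : realType) (a s : R) : s != 0 ->
  (normal_prob a s).-integrable [set: R] (fun x : R => x%:E).
Proof.
move=> s0.
(* Dominates the identity through [|x| <= |x - a| + |a|] and [|y| <= exp y + exp (- y)]. *)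
pose g (x : measurableTypeR R) : \bar R :=
  ((expR (1 * (x - a)))%:E + (expR (- 1 * (x - a)))%:E + `|a|%:E)%E.
have gi : (normal_prob a s).-integrable [set: R] g.
  apply: integrableD => //; last exact: finite_measure_integrable_cst.
  by apply: integrableD => //; exact: integrable_normal_prob_expR.
apply: (le_integrable measurableT _ _ gi); first exact/measurable_EFinP.
move=> x _; rewrite /g -!EFinD !abse_EFin lee_fin.
apply: (le_trans _ (ler_norm _)).
rewrite mul1r mulN1r -[X in `|X| <= _](subrK a).
rewrite (le_trans (ler_normD _ _))// lerD2r.
have := expR_ge1Dx (x - a); have := expR_ge1Dx (- (x - a)).
have := expR_gt0 (x - a); have := expR_gt0 (- (x - a)).
by rewrite ler_norml; lra.
Qed.

(* The mean is read off the moment generating function, via [1 + u <= exp u]. *)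
Lemma integral_normal_prob_id (R : realType) (a s : R) : s != 0 ->
  (\int[normal_prob a s]_x x%:E = a%:E)%E.
Proof.
move=> s0; have ix := integrable_normal_prob_id a s0.
have /fineK := integrable_fin_num measurableT ix.
set c := fine _ => cE; rewrite -cE; congr EFin.
apply/eqP; rewrite -subr_eq0; apply/eqP.
apply: (@eq0_of_expR_quadratic_bound _ _ (s ^+ 2 / 2)).
  by rewrite divr_ge0 ?sqr_ge0.
move=> b; rewrite -lee_fin mulrA -(normal_prob_mgf a)//.
have i1 : (normal_prob a s).-integrable [set: R] (cst (1 - b * a)%:E).
  exact: finite_measure_integrable_cst.
have ib : (normal_prob a s).-integrable [set: R] (fun x : R => b%:E * x%:E)%E.
  exact: integrableZl.
have -> : ((1 + b * (c - a))%:E =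
    \int[normal_prob a s]_x ((1 - b * a)%:E + b%:E * x%:E))%E.
  rewrite integralD//.
  have := expectation_cst (normal_prob a s) (1 - b * a).
  rewrite unlock => ->; rewrite integralZl// -cE.
  by rewrite -EFinM -EFinD; congr EFin; ring.
apply: le_integral => //; first exact: integrableD.
  exact: integrable_normal_prob_expR.
move=> x _; rewrite -EFinM -EFinD lee_fin.
by have := expR_ge1Dx (b * (x - a)); lra.
Qed.

(** The density being positive everywhere, a null open set would be Lebesgue-null, yet it contains a
    ball of positive radius. *)
Lemma normal_prob_open_gt0 (R : realType) (a s r : R) (U : set R) : s != 0 ->
  open U -> U r -> (0 < normal_prob a s U)%E.
Proof.
move=> s0 oU Ur; rewrite lt_neqAle measure_ge0 andbT eq_sym.
have mU : measurable U by exact: open_measurable.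
have mp : measurable_fun U (fun x => (normal_pdf a s x)%:E).
  by apply/measurable_EFinP; apply: measurable_funTS; exact: measurable_normal_pdf.
apply/eqP => NU0.
have : (\int[lebesgue_measure]_(x in U) `|(normal_pdf a s x)%:E| = 0)%E.
  rewrite -NU0 /normal_prob; apply: eq_integral => x _.
  by rewrite gee0_abs// lee_fin normal_pdf_ge0.
move=> /((ae_eq_integral_abs lebesgue_measure mU mp).1) U0.
have : lebesgue_measure U = 0%E.
  apply: measure_negligible => //; apply: negligibleS U0 => x Ux /= /(_ Ux) /eqP.
  rewrite eqe normal_pdfE// mulf_eq0 gt_eqF ?normal_peak_gt0//=.
  by rewrite gt_eqF// expR_gt0.
move: oU; rewrite openE => /(_ _ Ur) /nbhs_ballP[e /= e0 eU] leb0.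
have : (lebesgue_measure (ball r e) <= lebesgue_measure U)%E.
  by apply: le_measure => //; rewrite inE//; exact: measurable_ball.
rewrite leb0 lebesgue_measure_ball ?(ltW e0)// lee_fin leNgt.
by rewrite mulrn_wgt0.
Qed.

(** * Chi-square domination and testing *)

(** Cauchy-Schwarz from its weighted arithmetic-geometric form, which stays meaningful for infinite
    integrals. The weight [l = C / I] settles finite positive [I]; [l = 1] excludes [I] infinite
    with [J] finite. *)
Lemma sqre_le_of_young (R : realType) (I J : \bar R) (C : R) :
  0 < C -> (0 <= I)%E -> (0 <= J)%E ->
  (forall l : R, 0 < l -> (I + I <= l%:E * J + (C / l)%:E)%E) ->
  (I * I <= C%:E * J)%E.
Proof.
move=> C0 + + IJ; case: J IJ => [j| |] IJ; last by [].
- case: I IJ => [i| |] IJ; last by [].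
  + rewrite !lee_fin => i0 j0.
    have [->|i_neq0] := eqVneq i 0; first by rewrite mul0r mulr_ge0// ltW.
    have {i0 i_neq0} i0 : 0 < i by rewrite lt_neqAle eq_sym i_neq0.
    have := IJ (C / i) (divr_gt0 C0 i0).
    rewrite -EFinD -EFinM -EFinD lee_fin.
    have -> : C / (C / i) = i by field; rewrite !gt_eqF.
    rewrite lerD2r => /(ler_wpM2r (ltW i0)).
    by rewrite -mulrA (mulrC j) mulrA divfK ?gt_eqF.
  + by have := IJ 1 ltr01; rewrite -EFinM -EFinD.
- by move=> _ _; rewrite gt0_muley ?lte_fin// leey.
Qed.

(* Equivalent to [int (dP/dQ)^2 dQ <= C], but stated without densities so that
   products and images need no Radon-Nikodym derivative. *)
Definition chi2_le d (T : measurableType d) (R : realType)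
    (P Q : probability T R) (C : R) : Prop :=
  forall phi : T -> \bar R, measurable_fun setT phi -> (forall x, 0 <= phi x)%E ->
  ((\int[P]_x phi x) * (\int[P]_x phi x) <= C%:E * \int[Q]_x (phi x * phi x))%E.

(* [r] is the normalized [p^2 / q]. *)
Lemma chi2_le_of_density d (T : measurableType d) (R : realType)
    (mu : {measure set T -> \bar R}) (P Q : probability T R) (p q r : T -> R) (C : R) :
  measurable_fun setT p -> measurable_fun setT q -> measurable_fun setT r ->
  (forall x, 0 <= p x) -> (forall x, 0 <= q x) -> (forall x, 0 <= r x) ->
  (forall f, measurable_fun setT f -> (forall x, 0 <= f x)%E ->
     (\int[P]_x f x = \int[mu]_x (f x * (p x)%:E))%E) ->
  (forall f, measurable_fun setT f -> (forall x, 0 <= f x)%E ->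
     (\int[Q]_x f x = \int[mu]_x (f x * (q x)%:E))%E) ->
  0 < C -> (forall x, p x * p x = C * (q x * r x)) -> (\int[mu]_x (r x)%:E = 1)%E ->
  chi2_le P Q C.
Proof.
move=> mp mq mr p0 q0 r0 Pp Qq C0 pqr r1 phi mphi phi0.
have mpp : measurable_fun setT (fun x => phi x * phi x)%E by exact: emeasurable_funM.
have mphip : measurable_fun setT (fun x => phi x * (p x)%:E)%E.
  by apply: emeasurable_funM => //; exact/measurable_EFinP.
have mphiq : measurable_fun setT (fun x => phi x * phi x * (q x)%:E)%E.
  by apply: emeasurable_funM => //; exact/measurable_EFinP.
have phip0 x : (0 <= phi x * (p x)%:E)%E by rewrite mule_ge0// lee_fin.
have phiq0 x : (0 <= phi x * phi x * (q x)%:E)%E by rewrite !mule_ge0// lee_fin.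
rewrite Pp// Qq//; last by move=> x; rewrite mule_ge0.
(* It remains to integrate the pointwise inequality [2 phi p <= l phi^2 q + (C / l) r], whose last
   term has integral [C / l]. *)
apply: sqre_le_of_young => //; [exact: integral_ge0|exact: integral_ge0|].
move=> l l0; rewrite -ge0_integralD// -ge0_integralZl//; last by rewrite lee_fin ltW.
rewrite -[X in (_ + X)%E]mule1 -r1 -ge0_integralZl//; first last.
- by rewrite lee_fin divr_ge0 ?ltW.
- by move=> x _; rewrite lee_fin.
- exact/measurable_EFinP.
rewrite -ge0_integralD//; first last.
- apply: measurable_funeM; exact/measurable_EFinP.
- by move=> x _; rewrite -EFinM lee_fin mulr_ge0// divr_ge0 ?ltW.
- exact: measurable_funeM.
- by move=> x _; rewrite mule_ge0// lee_fin ltW.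
apply: ge0_le_integral => //.
- by move=> x _; rewrite adde_ge0.
- exact: emeasurable_funD.
- apply: emeasurable_funD; apply: measurable_funeM => //; exact/measurable_EFinP.
move=> x _; have := phi0 x; case: (phi x) => [t| |]//.
- rewrite -!EFinM -!EFinD !lee_fin => t0.
  have rE : C / l * r x * (l * q x) = p x * p x.
    by rewrite pqr; field; rewrite gt_eqF.
  (* Multiplying by [u > 0] and using [w * u = v * v] reduces this to [(t * u - v) ^+ 2 >= 0]; if
     [u = 0] then [v = 0]. *)
  suff H u v w : 0 <= u -> 0 <= w -> w * u = v * v -> t * v + t * v <= t * t * u + w.
    have := H (l * q x) (p x) (C / l * r x); rewrite rE mulrCA; apply => //.
      by rewrite mulr_ge0// ltW.
    by rewrite mulr_ge0// divr_ge0 ?ltW.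
  move=> u0 w0 wuv; have [u_eq0|u_neq0] := eqVneq u 0.
    move: wuv; rewrite u_eq0 mulr0 => /esym/eqP; rewrite mulf_eq0 orbb => /eqP ->.
    by rewrite !mulr0 !add0r.
  have {u0 u_neq0} u0 : 0 < u by rewrite lt_neqAle eq_sym u_neq0.
  rewrite -(ler_pM2l u0) mulrDr [leRHS]mulrDr (mulrC u w) wuv -subr_ge0.
  by have := sqr_ge0 (t * u - v); congr (0 <= _); ring.
(* Where [phi x] is infinite: if [p x = 0], the left side vanishes by the convention [+oo * 0 = 0];
   otherwise [p x * p x > 0] forces [q x > 0] and the right side is [+oo]. *)
- move=> _; have [p_eq0|p_neq0] := eqVneq (p x) 0.
    rewrite p_eq0 mule0 adde0; apply: adde_ge0.
      by apply: mule_ge0; [rewrite lee_fin ltW|rewrite mule_ge0// lee_fin].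
    by rewrite -EFinM lee_fin mulr_ge0// divr_ge0 ?ltW.
  have : 0 < p x * p x by rewrite lt_neqAle eq_sym mulf_neq0//= mulr_ge0.
  rewrite pqr pmulr_rgt0// => qr0.
  have qx0 : 0 < q x.
    rewrite lt_neqAle q0 andbT eq_sym; apply: contraTneq qr0 => ->.
    by rewrite mul0r ltxx.
  have -> : (+oo * +oo * (q x)%:E = +oo)%E by rewrite gt0_mulye ?lte_fin.
  by rewrite (gt0_muley (x := l%:E)) ?lte_fin// addye// leey.
Qed.

Lemma chi2_le_refl d (T : measurableType d) (R : realType) (P : probability T R) :
  chi2_le P P 1.
Proof.
apply: (@chi2_le_of_density _ _ _ P P P (cst 1) (cst 1) (cst 1)) => //.
- by move=> f _ _; apply: eq_integral => x _; rewrite mule1.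
- by move=> f _ _; apply: eq_integral => x _; rewrite mule1.
- by move=> x /=; rewrite !mulr1.
- under eq_integral do rewrite /=.
  by rewrite integral_cst// mul1e; exact: probability_setT.
Qed.

(** By Tonelli: the first bound is applied to the partial integral of [phi] in the second variable,
    then the second bound to each section of [phi]. *)
Lemma chi2_le_prod d1 d2 (T1 : measurableType d1) (T2 : measurableType d2)
    (R : realType) (P1 Q1 : probability T1 R) (P2 Q2 : probability T2 R) (C1 C2 : R) :
  0 <= C1 -> 0 <= C2 -> chi2_le P1 Q1 C1 -> chi2_le P2 Q2 C2 ->
  chi2_le (P1 \x P2)%E (Q1 \x Q2)%E (C1 * C2).
Proof.
move=> C10 C20 PQ1 PQ2 phi mphi phi0.
have mpp : measurable_fun setT (fun x => phi x * phi x)%E by exact: emeasurable_funM.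
have pp0 x : (0 <= phi x * phi x)%E by rewrite mule_ge0.
rewrite !fubini_tonelli1//.
have mF : measurable_fun setT (fubini_F P2 phi).
  exact: measurable_fun_fubini_tonelli_F.
have F0 x : (0 <= fubini_F P2 phi x)%E by apply: integral_ge0.
apply: (le_trans (PQ1 _ mF F0)).
rewrite EFinM -muleA; apply: lee_wpmul2l; first by rewrite lee_fin.
rewrite -ge0_integralZl//; last 2 first.
- exact: measurable_fun_fubini_tonelli_F.
- by move=> x _; apply: integral_ge0.
apply: ge0_le_integral => //.
- by move=> x _; exact: mule_ge0.
- exact: emeasurable_funM.
- apply: measurable_funeM; exact: measurable_fun_fubini_tonelli_F.
move=> x _; apply: PQ2 => //; exact: (measurableT_comp mphi (measurable_pair1 x)).
Qed.

Lemma chi2_le_distribution d1 d2 (T1 : measurableType d1) (T2 : measurableType d2)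
    (R : realType) (P Q : probability T1 R) (f : {mfun T1 >-> T2}) (C : R) :
  chi2_le P Q C -> chi2_le (distribution P f) (distribution Q f) C.
Proof.
move=> PQ phi mphi phi0.
rewrite !ge0_integral_distribution//; last 2 first.
- exact: emeasurable_funM.
- by move=> y; rewrite mule_ge0.
have mphif : measurable_fun setT (phi \o f) by exact: measurableT_comp.
by apply: (PQ _ mphif) => x; exact: phi0.
Qed.

Lemma chi2_le_iid d (T : measurableType d) (R : realType) (P Q : probability T R)
    (C : R) (n : nat) :
  0 <= C -> chi2_le P Q C -> chi2_le (iid P n) (iid Q n) (C ^+ n).
Proof.
move=> C0 PQ; elim: n => [|n IHn]; first by rewrite expr0; exact: chi2_le_refl.
rewrite exprS; apply: chi2_le_distribution; apply: chi2_le_prod => //.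
exact: exprn_ge0.
Qed.

Lemma chi2_le_testing d (T : measurableType d) (R : realType) (P Q : probability T R)
    (A : set T) :
  chi2_le P Q 2 -> measurable A -> ((2^-1)%:E <= Q A + P (~` A))%E.
Proof.
move=> PQ mA; have mI : measurable_fun setT (fun x => (\1_A x)%:E : \bar R).
  exact/measurable_EFinP/measurable_indic.
have I0 x : (0 <= (\1_A x)%:E :> \bar R)%E by rewrite lee_fin.
have := PQ _ mI I0.
under [in X in (_ <= X)%E -> _]eq_integral => x _.
  rewrite -EFinM indicE -natrM mulnb andbb -indicE; over.
rewrite !integral_indic// setIT probability_setC//.
move: (fin_num_measure P A mA) (fin_num_measure Q A mA).
suff aux (p q : \bar R) : p \is a fin_num -> q \is a fin_num ->
    (p * p <= 2%:E * q)%E -> ((2^-1)%:E <= q + (1 - p))%E by exact: aux.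
case: p => [p| |]// ; case: q => [q| |]// _ _.
rewrite -!EFinM -EFinB -EFinD !lee_fin => H.
(* Here [q + 1 - p >= p ^+ 2 / 2 + 1 - p = (1 + (p - 1) ^+ 2) / 2]. *)
have := sqr_ge0 (p - 1); nra.
Qed.

(** The squared density of mean [a] divided by the density of mean [b] is a constant times the
    density of mean [2 * a - b]; that constant is the chi-square moment. *)
Lemma chi2_le_normal_prob (R : realType) (a b s : R) : s != 0 ->
  chi2_le (normal_prob a s) (normal_prob b s) (expR ((a - b) ^+ 2 / s ^+ 2)).
Proof.
move=> s0; apply: (@chi2_le_of_density _ _ _ lebesgue_measure _ _
    (normal_pdf a s) (normal_pdf b s) (normal_pdf (2 * a - b) s)).
1-3: exact: measurable_normal_pdf.
1-3: by move=> x; exact: normal_pdf_ge0.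
1-2: by move=> f mf f0; exact: ge0_integral_normal_prob.
- exact: expR_gt0.
- move=> x; rewrite !normal_pdfE//.
  rewrite mulrACA [in RHS]mulrACA [RHS]mulrCA; congr (_ * _).
  by rewrite /normal_fun -!expRD; congr expR; field; rewrite s0.
- exact: integral_normal_pdf.
Qed.

(** * ReLU networks *)

Lemma measurable_coord (R : realType) (h : nat) (i : 'I_h) :
  measurable_fun setT (fun x : borel_vec R h => (x : 'cV[R]_h) i 0).
Proof.
apply: (measurability _ (RGenOpens.measurableE R)) => _ [_ [a [b ->]] <-].
rewrite setTI; apply: sub_sigma_algebra.
have /continuousP := @coord_continuous R h 1 i 0.
by apply; exact: interval_open.
Qed.

Lemma measurable_relu (R : realType) : measurable_fun setT (@relu R).
Proof. exact: measurable_maxr. Qed.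

Lemma reluM (R : realType) (c x : R) : 0 <= c -> relu (c * x) = c * relu x.
Proof. by move=> c0; rewrite /relu maxr_pMr// mulr0. Qed.

Lemma relu_ge0 (R : realType) (x : R) : 0 <= relu x.
Proof. by rewrite /relu le_max lexx. Qed.

Lemma relu_subN (R : realType) (x : R) : relu x - relu (- x) = x.
Proof.
rewrite /relu; have [x0|x0] := leP 0 x.
  by rewrite max_l ?oppr_le0// subr0.
by rewrite max_r ?oppr_ge0 ?ltW// opprK add0r.
Qed.

Lemma measurable_relu_hidden (R : realType) (k : nat -> nat) (W : weights R k)
    (l : nat) (i : 'I_(k l.+1)) :
  measurable_fun setT (fun x : borel_vec R (k 1%N) =>
    hidden (fun=> @relu R) W (x : 'cV[R]_(k 1%N)) l i 0).
Proof.
elim: l i => [|l IHl] i /=; first exact: measurable_coord.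
under eq_fun do rewrite !mxE.
apply: (measurableT_comp (@measurable_relu R)).
apply: measurable_sum => j; apply: measurable_funM => //.
Qed.

Lemma measurable_relu_network (R : realType) (k : nat -> nat) (L : nat)
    (W : weights R k) (w : 'cV[R]_(k L.+1)) :
  measurable_fun setT
    (network (fun=> @relu R) W w : borel_vec R (k 1%N) -> R).
Proof.
rewrite /network /dot; under eq_fun do rewrite !mxE.
apply: measurable_sum => j; apply: measurable_funM => //.
exact: measurable_relu_hidden.
Qed.

(** There are no biases, so the positive homogeneity of ReLU passes through every layer. *)
Lemma hidden_relu_scale (R : realType) (k : nat -> nat) (W : weights R k)
    (c : R) (x : 'cV[R]_(k 1%N)) (l : nat) :
  0 <= c ->
  hidden (fun=> @relu R) W (c *: x) l = c *: hidden (fun=> @relu R) W x l.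
Proof.
move=> c0; elim: l => [//|l IHl] /=.
by apply/matrixP => i j; rewrite IHl -scalemxAr !mxE reluM.
Qed.

Lemma network_relu_scale (R : realType) (k : nat -> nat) (L : nat)
    (W : weights R k) (w : 'cV[R]_(k L.+1)) (c : R) (x : 'cV[R]_(k 1%N)) :
  0 <= c ->
  network (fun=> @relu R) W w (c *: x) = c * network (fun=> @relu R) W w x.
Proof.
by move=> c0; rewrite /network hidden_relu_scale// /dot -scalemxAr mxE.
Qed.

(** By homogeneity a network is linear on each half-line from the origin. This linear growth makes
    every network integrable under a Gaussian carried by an axis. *)
Lemma network_relu_line_bound (R : realType) (k : nat -> nat) (L : nat)
    (W : weights R k) (w : 'cV[R]_(k L.+1)) (x : 'cV[R]_(k 1%N)) (z : R) :
  `|network (fun=> @relu R) W w (z *: x)| <=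
  (`|network (fun=> @relu R) W w x| + `|network (fun=> @relu R) W w (- x)|) * `|z|.
Proof.
set f := network _ _ _; have [z0|z0] := leP 0 z.
  by rewrite /f network_relu_scale// normrM [leLHS]mulrC ler_wpM2r// lerDl.
have Nz0 : 0 <= - z by rewrite oppr_ge0 ltW.
rewrite -[z]opprK scaleNr -scalerN /f network_relu_scale//.
by rewrite normrM [leLHS]mulrC !normrN ler_wpM2r// lerDr.
Qed.

(* Widths outside the network may be 0, so no index of value 0 is assumed. *)
Definition corner_mx (R : realType) (m n : nat) (c : R) : 'M[R]_(m, n) :=
  \matrix_(i, j) (if ((i : nat) == 0%N) && ((j : nat) == 0%N) then c else 0).

Lemma sum_ord0_if (R : realType) (n : nat) (c : R) :
  \sum_(i < n) (if (i : nat) == 0%N then c else 0) = if n is 0%N then 0 else c.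
Proof.
by case: n => [|n]; [rewrite big_ord0|rewrite big_ord_recl /= big1 ?addr0].
Qed.

(** Only an inequality, because the matrix may be empty and then has norm 0. *)
Lemma frobenius_norm_corner_mx_le (R : realType) (m n : nat) (c : R) :
  frobenius_norm (corner_mx m n c) <= `|c|.
Proof.
rewrite /frobenius_norm -sqrtr_sqr; apply: ler_wsqrtr.
under eq_bigr => i _.
  have -> : \sum_(j < n) corner_mx m n c i j ^+ 2 =
      if (i : nat) == 0%N then if n is 0%N then 0 else c ^+ 2 else 0.
    under eq_bigr do rewrite mxE.
    case: eqP => _ /=; last by rewrite big1// => j _; rewrite expr0n.
    rewrite -sum_ord0_if; apply: eq_bigr => j _.
    by case: eqP => // _; rewrite expr0n.
  over.
by rewrite sum_ord0_if; case: m n => [|m] [|n]//; rewrite sqr_ge0.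
Qed.

Lemma max_row_l1_norm_corner_mx_le (R : realType) (m n : nat) (c : R) :
  max_row_l1_norm (corner_mx m n c) <= `|c|.
Proof.
apply/bigmax_leP; split=> // i _.
under eq_bigr do rewrite mxE.
case: eqP => _ /=; last by rewrite big1// => j _; rewrite normr0.
rewrite (_ : \sum_(j < n) _ = if n is 0%N then 0 else `|c|); last first.
  by rewrite -sum_ord0_if; apply: eq_bigr => j _; case: eqP => // _; rewrite normr0.
by case: n.
Qed.

Lemma l2_norm_corner_mx_le (R : realType) (n : nat) (c : R) :
  l2_norm (corner_mx n 1 c) <= `|c|.
Proof.
apply: le_trans (frobenius_norm_corner_mx_le n 1 c).
by rewrite /l2_norm /frobenius_norm; under [in leRHS]eq_bigr do rewrite big_ord1.
Qed.

Lemma l1_norm_corner_mx_le (R : realType) (n : nat) (c : R) :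
  l1_norm (corner_mx n 1 c) <= `|c|.
Proof.
rewrite /l1_norm (_ : \sum_(i < n) _ = if n is 0%N then 0 else `|c|); last first.
  rewrite -sum_ord0_if; apply: eq_bigr => j _; rewrite mxE andbT.
  by case: eqP => // _; rewrite normr0.
by case: n.
Qed.

Lemma corner_mx_mul (R : realType) (m n : nat) (c : R) (v : 'cV[R]_n)
    (i : 'I_m) (j0 : 'I_n) : (j0 : nat) = 0%N ->
  (corner_mx m n c *m v) i 0 = if (i : nat) == 0%N then c * v j0 0 else 0.
Proof.
move=> j00; rewrite mxE; under eq_bigr do rewrite mxE.
case: eqP => _ /=; last by rewrite big1// => j _; rewrite mul0r.
rewrite (bigD1 j0)//= j00 eqxx big1 ?addr0// => j jj0.
rewrite ifF ?mul0r//; apply: contraNF jj0 => /eqP j0'.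
by apply/eqP/val_inj; rewrite /= j0' j00.
Qed.

Definition corner_weights (R : realType) (k : nat -> nat) (c : nat -> R) :
  weights R k := fun i => corner_mx (k i.+1) (k i) (c i).

(** The signal travels through the first coordinate of each layer. The sign of [c 1] is left free,
    to reach multiples of both [relu x_0] and [relu (- x_0)]; the later factors are nonnegative and
    so come out of the ReLUs. *)
Lemma hidden_corner_weights (R : realType) (k : nat -> nat) (c : nat -> R)
    (L : nat) (x : 'cV[R]_(k 1%N)) (i0 : 'I_(k 1%N)) (i : 'I_(k L.+2)) :
  (i0 : nat) = 0%N ->
  (forall l, (1 <= l <= L.+1)%N -> (0 < k l)%N) ->
  (forall l, (2 <= l <= L.+1)%N -> 0 <= c l) ->
  hidden (fun=> @relu R) (corner_weights k c) x L.+1 i 0 =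
  if (i : nat) == 0%N
  then (\prod_(2 <= l < L.+2) c l) * relu (c 1%N * x i0 0) else 0.
Proof.
move=> i00; have relu0 : relu (0 : R) = 0 by rewrite /relu maxxx.
elim: L i => [|L IHL] i kpos cpos.
  rewrite /= mxE (corner_mx_mul _ _ _ i00) big_nil mul1r.
  by case: eqP.
have kL : (0 < k L.+2)%N by apply: kpos; rewrite /= leqnn.
rewrite [hidden _ _ _ _]/= mxE (@corner_mx_mul _ _ _ _ _ _ (Ordinal kL))//.
case: eqP => // _; rewrite reluM; last by apply: cpos; rewrite /= leqnn.
have -> := IHL (Ordinal kL).
- rewrite /= (big_nat_recr L.+2)//= [_ * c _]mulrC -mulrA; congr (_ * _).
  (* The signal is already nonnegative after the first layer, so the outer ReLU acts as the
     identity. *)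
  rewrite {1}/relu max_r// mulr_ge0 ?relu_ge0// big_nat_cond.
  apply: prodr_ge0 => l; rewrite andbT ltnS => /andP[l2 lL].
  by apply: cpos; rewrite l2 ltnW.
- by move=> l /andP[l1 lL]; apply: kpos; rewrite l1 ltnW.
- by move=> l /andP[l1 lL]; apply: cpos; rewrite l1 ltnW.
Qed.

Lemma network_corner_weights (R : realType) (k : nat -> nat) (c : nat -> R) (b : R)
    (L : nat) (x : 'cV[R]_(k 1%N)) (i0 : 'I_(k 1%N)) :
  (i0 : nat) = 0%N ->
  (forall l, (1 <= l <= L.+2)%N -> (0 < k l)%N) ->
  (forall l, (2 <= l <= L.+1)%N -> 0 <= c l) ->
  network (fun=> @relu R) (corner_weights k c) (corner_mx (k L.+2) 1 b) x =
  b * ((\prod_(2 <= l < L.+2) c l) * relu (c 1%N * x i0 0)).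
Proof.
move=> i00 kpos cpos; rewrite /network /dot.
have kL : (0 < k L.+2)%N by apply: kpos; rewrite /= leqnn.
have kpos' l : (1 <= l <= L.+1)%N -> (0 < k l)%N.
  by move=> /andP[l1 lL]; apply: kpos; rewrite l1 ltnW.
have <- : hidden (fun=> @relu R) (corner_weights k c) x L.+1 (Ordinal kL) 0 =
    (\prod_(2 <= l < L.+2) c l) * relu (c 1%N * x i0 0).
  exact: hidden_corner_weights.
rewrite mxE (bigD1 (Ordinal kL))//= big1 ?addr0; first by rewrite !mxE.
move=> i iN; rewrite !mxE ifF ?mul0r// andbT.
by apply: contraNF iN => /eqP i0'; apply/eqP/val_inj.
Qed.

(** * Gaussian measures on an axis *)

Definition axis (R : realType) (h : nat) (i0 : 'I_h) (z : R) : borel_vec R h :=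
  z *: (delta_mx i0 0 : 'cV[R]_h).

Lemma axisE (R : realType) (h : nat) (i0 i : 'I_h) (z : R) :
  (axis i0 z : 'cV[R]_h) i 0 = if i == i0 then z else 0.
Proof. by rewrite !mxE eqxx andbT; case: eqP => _; rewrite ?mulr1 ?mulr0. Qed.

Lemma continuous_axis (R : realType) (h : nat) (i0 : 'I_h) :
  continuous (axis i0 : R -> 'cV[R]_h).
Proof. exact: scalel_continuous. Qed.

Lemma measurable_axis (R : realType) (h : nat) (i0 : 'I_h) :
  measurable_fun [set: measurableTypeR R]
    (@axis R h i0 : measurableTypeR R -> borel_vec R h).
Proof.
apply: (@measurability _ _ _ (borel_vec R h) setT (@axis R h i0)
  (@open 'cV[R]_h)) => // _ [U oU <-].
rewrite setTI; apply: open_measurable.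
by have /continuousP := @continuous_axis R h i0; apply.
Qed.

Definition axis_mfun (R : realType) (h : nat) (i0 : 'I_h) :
    {mfun measurableTypeR R >-> borel_vec R h} :=
  @MeasurableFun.Pack _ _ (measurableTypeR R) (borel_vec R h) _
    (MeasurableFun.Class (isMeasurableFun.Build _ _ _ _ _ (@measurable_axis R h i0))).

Definition axis_normal (R : realType) (h : nat) (i0 : 'I_h) (a s : R) :
  probability (borel_vec R h) R := distribution (normal_prob a s) (axis_mfun R i0).

Lemma integral_axis_normal (R : realType) (h : nat) (i0 : 'I_h) (a s : R)
    (f : borel_vec R h -> \bar R) :
  measurable_fun setT f -> (normal_prob a s).-integrable setT (f \o axis i0) ->
  (\int[axis_normal i0 a s]_x f x = \int[normal_prob a s]_z f (axis i0 z))%E.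
Proof. by move=> mf intf; rewrite integral_distribution. Qed.

Lemma integrable_axis_coord (R : realType) (h : nat) (i0 i : 'I_h) (a s : R) :
  s != 0 ->
  (normal_prob a s).-integrable setT
    ((fun x : borel_vec R h => ((x : 'cV[R]_h) i 0)%:E) \o axis i0).
Proof.
move=> s0; rewrite (_ : _ \o _ = fun z : R => (if i == i0 then z else 0)%:E).
  by case: eqP => _; [exact: integrable_normal_prob_id|exact: integrable0].
by apply/funext => z /=; rewrite axisE.
Qed.

Lemma measurable_coordE (R : realType) (h : nat) (i : 'I_h) :
  measurable_fun setT (fun x : borel_vec R h => ((x : 'cV[R]_h) i 0)%:E).
Proof. by apply/measurable_EFinP; exact: measurable_coord. Qed.

Lemma mean_axis_normal (R : realType) (h : nat) (i0 : 'I_h) (a s : R) :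
  s != 0 -> mean_vec (axis_normal i0 a s) = axis i0 a.
Proof.
move=> s0; apply/colP => i; rewrite axisE mxE unlock integral_axis_normal.
- under eq_integral do rewrite axisE.
  by case: eqP => _; [rewrite integral_normal_prob_id|rewrite integral0].
- exact: measurable_coordE.
- exact: integrable_axis_coord.
Qed.

Lemma l2_norm_axis (R : realType) (h : nat) (i0 : 'I_h) (a : R) :
  l2_norm (axis i0 a) = `|a|.
Proof.
rewrite /l2_norm -sqrtr_sqr (bigD1 i0)//= big1 ?addr0 => [|i /negPf ii0].
  by rewrite axisE eqxx.
by rewrite axisE ii0 expr0n.
Qed.

Lemma coord_le_l2_norm (R : realType) (h : nat) (i0 : 'I_h) (v : 'cV[R]_h) :
  v i0 0 ^+ 2 <= l2_norm v ^+ 2.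
Proof.
rewrite sqr_sqrtr ?sumr_ge0// => [|i _]; last exact: sqr_ge0.
by rewrite (bigD1 i0)//= lerDl sumr_ge0// => i _; exact: sqr_ge0.
Qed.

Lemma dot_axis (R : realType) (h : nat) (i0 : 'I_h) (v : 'cV[R]_h) (z : R) :
  dot v (axis i0 z) = v i0 0 * z.
Proof.
rewrite /dot mxE (bigD1 i0)//= big1 ?addr0 => [|i /negPf ii0].
  by rewrite axisE eqxx mxE.
by rewrite axisE ii0 mulr0.
Qed.

(** Along the axis only [v i0 0] enters the exponent, so the one-dimensional moment generating
    function applies, followed by [coord_le_l2_norm]. *)
Lemma sub_gaussian_axis_normal (R : realType) (h : nat) (i0 : 'I_h) (a s : R) :
  s != 0 -> sub_gaussian (axis_normal i0 a s) s.
Proof.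
move=> s0 v /=; rewrite mean_axis_normal// unlock.
have mZ : measurable_fun setT (fun x : borel_vec R h =>
    (expR (dot v ((x : 'cV[R]_h) - axis i0 a)))%:E).
  apply/measurable_EFinP; apply: measurableT_comp => //.
  rewrite /dot; under eq_fun do rewrite mxE.
  apply: measurable_sum => i; apply: measurable_funM => //.
  under eq_fun do rewrite 2!mxE.
  by apply: measurable_funB => //; exact: measurable_coord.
have ZE z : (expR (dot v ((axis i0 z : 'cV[R]_h) - axis i0 a)))%:E =
    (expR (v i0 0 * (z - a)))%:E.
  by rewrite /axis -scalerBl -/(axis i0 (z - a)) dot_axis.
rewrite integral_axis_normal//; last first.
  by rewrite /comp; under eq_fun do rewrite ZE; exact: integrable_normal_prob_expR.
under eq_integral do rewrite ZE.
rewrite normal_prob_mgf// lee_fin ler_expR !ler_pM2r// ?invr_gt0//.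
  exact: coord_le_l2_norm.
by rewrite exprn_even_gt0.
Qed.

Lemma unbounded_msupport_axis_normal (R : realType) (h : nat) (i0 : 'I_h) (a s : R) :
  s != 0 -> ~ bounded_set (msupport (axis_normal i0 a s)).
Proof.
move=> s0 [M [_ MB]].
(* [MB] bounds the support by any number above [M], in particular by [|M| + 1]; the axis point at
   [|M| + 2] lies in the support and violates this. *)
have M0 : M < `|M| + 1 by rewrite (le_lt_trans (ler_norm _))// ltrDl.
have /(MB _ M0) : msupport (axis_normal i0 a s) (axis i0 (`|M| + 2)).
  move=> U oU Ux; apply: (@normal_prob_open_gt0 _ a s (`|M| + 2) (axis i0 @^-1` U)) => //.
  by have /continuousP := @continuous_axis R h i0; apply.
apply/negP; rewrite -ltNge.
apply: (@lt_le_trans _ _ `|(axis i0 (`|M| + 2) : 'cV[R]_h) i0 0|).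
  rewrite axisE eqxx [ltRHS]ger0_norm ?addr_ge0// ltrD2l.
  by rewrite ltr1n.
rewrite [leRHS]/Num.norm /= mx_normrE; apply/bigmax_geP; right => /=.
by exists (i0, 0).
Qed.

(** The standard deviation is [G], the largest sub-Gaussian parameter allowed, which makes a shift
    of the mean hardest to detect. *)
Lemma axis_normal_P_uB (R : realType) (h : nat) (i0 : 'I_h) (a G : R) :
  0 < G -> `|a| <= G -> @P_uB R h G (axis_normal i0 a G).
Proof.
move=> G0 aG; have GN0 : G != 0 by rewrite gt_eqF.
split.
- exact: unbounded_msupport_axis_normal.
- move=> i; apply: (integrable_pushforward (@measurable_axis R h i0)) => //.
  + exact: measurable_coordE.
  + exact: integrable_axis_coord.
- by rewrite mean_axis_normal// l2_norm_axis.
- by exists G; [rewrite G0 lexx|exact: sub_gaussian_axis_normal].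
Qed.

Lemma integrable_network_axis (R : realType) (k : nat -> nat) (L : nat)
    (W : weights R k) (w : 'cV[R]_(k L.+1)) (i0 : 'I_(k 1%N)) (a s : R) : s != 0 ->
  (normal_prob a s).-integrable setT
    (fun z : R => (network (fun=> @relu R) W w (axis i0 z))%:E).
Proof.
move=> s0; pose e : 'cV[R]_(k 1%N) := delta_mx i0 0.
pose K := `|network (fun=> @relu R) W w e| + `|network (fun=> @relu R) W w (- e)|.
have gi : (normal_prob a s).-integrable [set: R] (fun z : R => K%:E * z%:E)%E.
  by apply: integrableZl => //; exact: integrable_normal_prob_id.
apply: (le_integrable measurableT _ _ gi).
  apply/measurable_EFinP.
  exact: (measurableT_comp (measurable_relu_network W w) (@measurable_axis R _ i0)).
move=> z _; rewrite -EFinM !abse_EFin lee_fin normrM [`|K|]ger0_norm ?addr_ge0//.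
exact: network_relu_line_bound.
Qed.

Lemma expectation_network_axis (R : realType) (k : nat -> nat) (L : nat)
    (W : weights R k) (w : 'cV[R]_(k L.+1)) (i0 : 'I_(k 1%N)) (a s : R) : s != 0 ->
  ('E_(axis_normal i0 a s)[network (fun=> @relu R) W w] =
   \int[normal_prob a s]_z (network (fun=> @relu R) W w (axis i0 z))%:E)%E.
Proof.
move=> s0; rewrite unlock integral_axis_normal//.
  by apply/measurable_EFinP; exact: measurable_relu_network.
exact: integrable_network_axis.
Qed.

(** * The two-point lower bound *)

Lemma chi2_le_weaken d (T : measurableType d) (R : realType) (P Q : probability T R)
    (C C' : R) :
  C <= C' -> chi2_le P Q C -> chi2_le P Q C'.
Proof.
move=> CC' PQ phi mphi phi0; apply: (le_trans (PQ _ mphi phi0)).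
by apply: lee_wpmul2r; rewrite ?lee_fin// integral_ge0// => x _; rewrite mule_ge0.
Qed.

Lemma measurable_error (d : measure_display) (T : measurableType d) (R : realType)
    (D : \bar R) (f : T -> R) (c : R) :
  measurable_fun setT f ->
  measurable [set x | c%:E <= `| D - (f x)%:E |]%E.
Proof.
move=> mf; rewrite -[X in measurable X]setTI.
apply: emeasurable_fun_c_infty => //; apply: measurableT_comp => //.
by apply: emeasurable_funB => //; exact/measurable_EFinP.
Qed.

(** Thresholding the estimator at [c] yields a test: a value at least [c] errs by at least [c] under
    the first pair, a value below [c] errs by more than [c] under the second. The two error
    probabilities sum to at least 1/2, so the larger is at least 1/4. An infinite distance makes the
    error infinite. *)
Lemma le_cam (R : realType) (h n m : nat) (F : set (borel_vec R h -> R))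
    (Q : set (probability (borel_vec R h) R)) (c : R)
    (mu nu mu' nu' : probability (borel_vec R h) R) :
  Q mu -> Q nu -> Q mu' -> Q nu' ->
  (net_distance F mu nu <= 0)%E -> ((c + c)%:E <= net_distance F mu' nu')%E ->
  chi2_le (iid mu' n \x iid nu' m)%E (iid mu n \x iid nu m)%E 2 ->
  ((4^-1)%:E <= minimax_prob F Q n m c)%E.
Proof.
move=> Qmu Qnu Qmu' Qnu' D0 D1 PQ; apply: le_ereal_inf_tmp => _ [dhat /= mdhat <-].
set S := ereal_sup _.
pose A := [set s | c <= dhat s].
have mA : measurable A.
  rewrite -[A]setTI; have := mdhat measurableT `[c, +oo[%classic (measurable_itv _).
  by congr measurable; apply/seteqP; split => x /=; rewrite in_itv /= andbT.
have SQ : ((iid mu n \x iid nu m)%E A <= S)%E.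
  apply: (@le_trans _ _ ((iid mu n \x iid nu m)%E
      [set s | c%:E <= `| net_distance F mu nu - (dhat s)%:E |]%E)); last first.
    by apply: ereal_sup_ubound; exists mu => //; exists nu.
  apply: le_measure; rewrite ?inE//; first exact: measurable_error.
  move=> x /=; rewrite /A /=; move: D0; case: (net_distance F mu nu) => [r| |]//=.
    rewrite lee_fin => r0 cx; rewrite lee_fin distrC.
    by apply: le_trans (ler_norm _); lra.
  by move=> _ _; rewrite leey.
have SP : ((iid mu' n \x iid nu' m)%E (~` A) <= S)%E.
  apply: (@le_trans _ _ ((iid mu' n \x iid nu' m)%E
      [set s | c%:E <= `| net_distance F mu' nu' - (dhat s)%:E |]%E)); last first.
    by apply: ereal_sup_ubound; exists mu' => //; exists nu'.
  apply: le_measure; rewrite ?inE//; [exact: measurableC|exact: measurable_error|].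
  move=> x /=; rewrite /A /=; move: D1; case: (net_distance F mu' nu') => [r| |]//=.
    rewrite lee_fin => r0 /negP; rewrite -ltNge => cx; rewrite lee_fin.
    by apply: le_trans (ler_norm _); lra.
  by move=> _ _; rewrite leey.
have := le_trans (chi2_le_testing PQ mA) (leeD SQ SP).
case: S {SQ SP} => [r| |]//; last by move=> _; rewrite leey.
by rewrite -EFinD !lee_fin; lra.
Qed.

Section lower_bound.
Context (R : realType) (k : nat -> nat) (L : nat) (M : nat -> R).
Hypothesis k_gt0 : forall l, (1 <= l <= L.+2)%N -> (0 < k l)%N.
Hypothesis M_gt0 : forall l, (1 <= l <= L.+2)%N -> 0 < M l.

Let i0 : 'I_(k 1%N) := Ordinal (k_gt0 (isT : (1 <= 1 <= L.+2)%N)).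
Let prodM := \prod_(1 <= l < L.+3) M l.
(** Each layer spends its whole norm budget on one entry. The sign [e] sits in the first layer,
    ahead of every ReLU. *)
Let ray (e : R) : weights R k * 'cV[R]_(k L.+2) :=
  (corner_weights k (fun l => if l == 1%N then e * M l else M l),
   corner_mx (k L.+2) 1 (M L.+2)).

Let ray_axis (e z : R) :
  network (fun=> @relu R) (ray e).1 (ray e).2 (axis i0 z) = prodM * relu (e * z).
Proof.
rewrite /ray (network_corner_weights _ _ (i0 := i0))//=; last first.
  move=> [//|[//|l]] /= lL; apply: ltW; apply: M_gt0.
  by rewrite /= ltnW.
have M1 : 0 <= M 1%N by apply/ltW/M_gt0.
rewrite axisE eqxx (_ : e * M 1%N * z = M 1%N * (e * z)); last by ring.
rewrite reluM//.
have -> : prodM = M 1%N * (\prod_(2 <= l < L.+2) M l) * M L.+2.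
  by rewrite /prodM big_nat_recr//=; congr (_ * _); rewrite big_ltn.
rewrite (eq_big_nat _ _ (F2 := M)) => [|[|[|l]]]//.
by ring.
Qed.

Variable Theta : set (weights R k * 'cV[R]_(k L.+2)).
Hypothesis Theta_ray : forall e, `|e| = 1 -> Theta (ray e).
Local Notation F := (network_class (L := L.+1) (fun=> @relu R) Theta).

(** In [\bar R], [x - x = 0] requires [x] to be finite, which the integrability of the networks
    supplies. *)
Let net_distance_axis_self (a s : R) : s != 0 ->
  (net_distance F (axis_normal i0 a s) (axis_normal i0 a s) <= 0)%E.
Proof.
move=> s0; apply: ge_ereal_sup => _ [_ [[W w] _ <-] <-] /=.
rewrite expectation_network_axis// subee ?abse0//.
by apply: integrable_fin_num => //; exact: integrable_network_axis.
Qed.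

Let net_distance_axis_ge (a b s : R) : s != 0 ->
  ((prodM * `|a - b| / 2)%:E <=
    net_distance F (axis_normal i0 a s) (axis_normal i0 b s))%E.
Proof.
move=> s0.
pose E x e := fine (\int[normal_prob x s]_z
  (network (fun=> @relu R) (ray e).1 (ray e).2 (axis i0 z))%:E)%E.
have ir x e : (normal_prob x s).-integrable [set: R]
    (fun z : R => (network (fun=> @relu R) (ray e).1 (ray e).2 (axis i0 z))%:E).
  exact: integrable_network_axis.
have fr x e := integrable_fin_num measurableT (ir x e).
have EE x e : ('E_(axis_normal i0 x s)[network (fun=> @relu R) (ray e).1 (ray e).2]
    = (E x e)%:E)%E.
  by rewrite expectation_network_axis// fineK//; exact: fr.
have EB x : E x 1 - E x (-1) = prodM * x.
  apply/EFin_inj; rewrite EFinB !fineK ?fr//.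
  rewrite -(integralB_EFin measurableT (ir x 1) (ir x (-1))).
  under eq_integral do rewrite !ray_axis -EFinB -mulrBr mul1r mulN1r relu_subN EFinM.
  rewrite integralZl//; last exact: integrable_normal_prob_id.
  by rewrite integral_normal_prob_id.
clearbody E.
have ub e : `|e| = 1 -> (`|E a e - E b e|%:E <=
    net_distance F (axis_normal i0 a s) (axis_normal i0 b s))%E.
  move=> e1; apply: ereal_sup_ubound.
  exists (network (fun=> @relu R) (ray e).1 (ray e).2).
    by exists (ray e) => //; exact: Theta_ray.
  by rewrite !EE.
have P0 : 0 <= prodM.
  rewrite /prodM big_nat_cond; apply: prodr_ge0 => l; rewrite andbT ltnS => lL.
  by rewrite ltW// M_gt0.
have := ler_normB (E a 1 - E b 1) (E a (-1) - E b (-1)).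
have -> : E a 1 - E b 1 - (E a (-1) - E b (-1)) = prodM * (a - b).
  by rewrite mulrBr; move: (EB a) (EB b); lra.
rewrite normrM (ger0_norm P0) => tri.
(* The two shifts differ by [prodM * (a - b)], so if the first is below half of this in absolute
   value, the second is above half. *)
have [le1|lt1] := leP (prodM * `|a - b| / 2) `|E a 1 - E b 1|.
  by apply: le_trans (ub 1 _); rewrite ?lee_fin// normr1.
by apply: le_trans (ub (-1) _); rewrite ?lee_fin ?normrN1//; lra.
Qed.

Lemma minimax_relu_lower_bound (Gamma : R) (n m : nat) :
  0 < Gamma -> (0 < n)%N -> (0 < m)%N ->
  ((4^-1)%:E <= minimax_prob F (@P_uB R (k 1%N) Gamma) n m
    (8 / 100 * Gamma * prodM
      * Num.max (n%:R `^ (- 2^-1)) (m%:R `^ (- 2^-1)))%R)%E.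
Proof.
move=> G0 n0 m0; have GN0 : Gamma != 0 by rewrite gt_eqF.
have P0 : 0 <= prodM.
  rewrite /prodM big_nat_cond; apply: prodr_ge0 => l; rewrite andbT ltnS => lL.
  by rewrite ltW// M_gt0.
pose mu a := axis_normal i0 a Gamma.
have Q0 : @P_uB R (k 1%N) Gamma (mu 0).
  by apply: axis_normal_P_uB => //; rewrite normr0 ltW.
pose delta t := Gamma * t / 2.
have tP N : (0 < N)%N -> let t := N%:R `^ (- 2^-1) : R in
    [/\ 0 <= t, t <= 1 & t ^+ 2 * N%:R = 1].
  move=> N0; rewrite powRN powR12_sqrt//; split.
  - by rewrite invr_ge0.
  - by rewrite invf_le1 ?sqrtr_gt0 ?ltr0n// -[leLHS]sqrtr1 ler_wsqrtr// ler1n.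
  - by rewrite exprVn sqr_sqrtr// mulVf// pnatr_eq0 -lt0n.
have Qd N : (0 < N)%N -> @P_uB R (k 1%N) Gamma (mu (delta (N%:R `^ (- 2^-1)))).
  move=> /tP[t0 t1 _]; apply: axis_normal_P_uB => //.
  by rewrite ger0_norm /delta; nra.
have chi N : (0 < N)%N ->
    chi2_le (iid (mu (delta (N%:R `^ (- 2^-1)))) N) (iid (mu 0) N) 2.
  move=> /tP[t0 t1 tN].
  apply: (@chi2_le_weaken _ _ _ _ _
      (expR ((delta (N%:R `^ (- 2^-1)) - 0) ^+ 2 / Gamma ^+ 2) ^+ N)).
    (* One draw costs [exp (delta^2 / Gamma^2) = exp (1 / (4 N))], so [N] draws cost [exp (1/4)]. *)
    rewrite -expRM_natl (_ : _ * _ = 4^-1); last first.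
      transitivity (((N%:R `^ (- 2^-1)) ^+ 2 * N%:R) / 4 : R); last by rewrite tN mul1r.
      by rewrite /delta; field; rewrite GN0.
    (* From [exp (- 1/4) >= 3/4] follows [exp (1/4) <= 4/3 <= 2]. *)
    have := expR_ge1Dx (- 4^-1 : R); rewrite expRN => e4.
    have e0 := expR_gt0 (4^-1 : R).
    by rewrite -[leRHS]invrK -lef_pV2 ?posrE ?invr_gt0//; lra.
  apply: chi2_le_iid; first exact: expR_ge0.
  by apply: chi2_le_distribution; exact: chi2_le_normal_prob.
(* Twice the threshold constant is [0.16], below the [1/4] obtained by halving
   [delta t = Gamma * t / 2]. *)
have dist t : 0 <= t ->
  8 / 100 * Gamma * prodM * t + 8 / 100 * Gamma * prodM * t
    <= prodM * `|delta t| / 2.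
  move=> t0; rewrite ger0_norm /delta; last by rewrite !mulr_ge0// ltW.
  have : 0 <= Gamma * prodM * t by rewrite !mulr_ge0// ltW.
  lra.
(* The maximum belongs to the smaller sample, so only the measure of that sample is shifted; the
   other sample has the same law under both pairs and contributes the factor 1. *)
have [_|_] := leP (n%:R `^ (- 2^-1) : R) (m%:R `^ (- 2^-1)).
- have [t0 _ _] := tP _ m0.
  apply: (le_cam Q0 Q0 Q0 (Qd _ m0)).
  + exact: net_distance_axis_self.
  + apply: le_trans (net_distance_axis_ge _ _ GN0).
    by rewrite lee_fin distrC subr0 dist.
  + apply: (@chi2_le_weaken _ _ _ _ _ (1 * 2)); first by rewrite mul1r.
    exact: chi2_le_prod ler01 (ler0n _ _) (chi2_le_refl _) (chi _ m0).
- have [t0 _ _] := tP _ n0.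
  apply: (le_cam Q0 Q0 (Qd _ n0) Q0).
  + exact: net_distance_axis_self.
  + apply: le_trans (net_distance_axis_ge _ _ GN0).
    by rewrite lee_fin subr0 dist.
  + apply: (@chi2_le_weaken _ _ _ _ _ (2 * 1)); first by rewrite mulr1.
    exact: chi2_le_prod (ler0n _ _) ler01 (chi _ n0) (chi2_le_refl _).
Qed.

End lower_bound.

Theorem corollary1 (R : realType) (d : nat) (k : nat -> nat)
    (M_F M_1oo : nat -> R) (Gamma : R) (m n : nat)
    (d_ge2 : (2 <= d)%N)
    (k_ge1 : forall i, (1 <= i <= d)%N -> (1 <= k i)%N)
    (M_F_gt0 : forall i, (1 <= i <= d)%N -> 0 < M_F i)
    (M_1oo_gt0 : forall i, (1 <= i <= d)%N -> 0 < M_1oo i)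
    (Gamma_gt0 : 0 < Gamma)
    (m_ge1 : (1 <= m)%N) (n_ge1 : (1 <= n)%N) :
  let threshold (M : nat -> R) : R :=
    8 / 100 * Gamma * (\prod_(1 <= i < d.+1) M i)
      * Num.max (n%:R `^ (- 2^-1)) (m%:R `^ (- 2^-1)) in
  let minimax (M : nat -> R) Theta : \bar R :=
    minimax_prob (network_class (L := d.-1) (fun=> @relu R) Theta)
      (@P_uB R (k 1%N) Gamma) n m (threshold M) in
  ((4^-1)%:E <= minimax M_F (params_frobenius M_F))%E
  /\
  ((4^-1)%:E <= minimax M_1oo (params_max_row_l1 M_1oo))%E.
Proof.
case: d d_ge2 k_ge1 M_F_gt0 M_1oo_gt0 => [|[|L]]// _ k_ge1 MF0 M10.
(* The sign leaves the absolute value of the corner entry unchanged, so both networks respect the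
   norm bounds. *)
have normE M e i : (forall l, (1 <= l <= L.+2)%N -> 0 < M l) -> `|e| = 1 ->
    (1 <= i <= L.+1)%N -> `|if i == 1%N then e * M i else M i| = M i :> R.
  move=> M0 e1 /andP[i1 iL]; have /ltW Mi : 0 < M i by rewrite M0// i1 ltnW.
  by case: eqP => _; rewrite ?normrM ?e1 ?mul1r ger0_norm.
split; apply: minimax_relu_lower_bound => // e e1.
- split=> [i iL|] /=.
    by rewrite -[leRHS](normE _ _ _ MF0 e1 iL); exact: frobenius_norm_corner_mx_le.
  by rewrite -[leRHS]ger0_norm ?l2_norm_corner_mx_le// ltW// MF0//= leqnn.
- split=> [i iL|] /=.
    by rewrite -[leRHS](normE _ _ _ M10 e1 iL); exact: max_row_l1_norm_corner_mx_le.
  by rewrite -[leRHS]ger0_norm ?l1_norm_corner_mx_le// ltW// M10//= leqnn.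
Qed.
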